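(* Let $X$ be a set such that $|X|\ge\aleph_1$ is a regular cardinal, and let $\alpha,\beta\in\mathcal P_X$. Then $\mathcal P_X=\langle\mathcal S_X\cup\{\alpha,\beta\}\rangle$ if and only if, up to interchanging the names of $\alpha$ and $\beta$ if necessary, $\alpha\in\mathcal L_X$, $\beta\in\mathcal R_X$, $d^*(\alpha)=d(\beta)=|X|$, and either (i) $k^*(\alpha,2)+d^*(\alpha,2)=|X|=k(\beta,|X|)+d(\beta,|X|)$, or (ii) $k^*(\alpha,|X|)+d^*(\alpha,|X|)=|X|=k(\beta,2)+d(\beta,2)$.
   Context: Partition monoid: let $X'=\{x':x\in X\}$ be a disjoint copy of the set $X$; for $A\subseteq X$ write $A'=\{a':a\in A\}$. The elements of $\mathcal P_X$ are all set partitions $\alpha$ of $X\cup X'$ into nonempty blocks. Product: given $\alpha,\beta\in\mathcal P_X$, let $X''=\{x'':x\in X\}$ be a third disjoint copy of $X$; relabel each lower vertex $x'$ of (a graph whose connected components are the blocks of) $\alpha$ as $x''$, relabel each upper vertex $x$ of (a graph representing) $\beta$ as $x''$, and take the union of the two graphs on vertex set $X\cup X''\cup X'$. Then $\alpha\beta\in\mathcal P_X$ is the partition in which $u,v\in X\cup X'$ lie in the same block if and only if they are joined by a (finite) path in this graph. This makes $\mathcal P_X$ a monoid with identity $\{\{x,x'\}:x\in X\}$. $\mathcal S_X$ denotes the group of units of $\mathcal P_X$: the partitions all of whose blocks have the form $\{x,y'\}$ with $x,y\in X$. For $T\subseteq\mathcal P_X$, $\langle T\rangle$ is the subsemigroup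 generated by $T$. $\mathcal L_X$ is the set of $\alpha\in\mathcal P_X$ such that every $x\in X$ lies in a block meeting $X'$ and distinct elements of $X$ lie in distinct blocks. $\mathcal R_X$ is the set of $\alpha\in\mathcal P_X$ such that every $x'\in X'$ lies in a block meeting $X$ and distinct elements of $X'$ lie in distinct blocks. Parameters: write the blocks of $\alpha\in\mathcal P_X$ as transversal blocks $A_i\cup B_i'$ ($i\in I$) with $A_i,B_i\subseteq X$ nonempty, upper nontransversal blocks $C_j\subseteq X$ ($j\in J$), and lower nontransversal blocks $D_k'\subseteq X'$ ($k\in K$). For a cardinal $\mu\le|X|$ put $k(\alpha,\mu)=|\{i\in I:|A_i|\ge\mu\}|$, $k^*(\alpha,\mu)=|\{i\in I:|B_i|\ge\mu\}|$, $d(\alpha,\mu)=|\{j\in J:|C_j|\ge\mu\}|$, $d^*(\alpha,\mu)=|\{k\in K:|D_k|\ge\mu\}|$, and $d(\alpha)=d(\alpha,1)=|J|$, $d^*(\alpha)=d^*(\alpha,1)=|K|$. *)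

(* Defs.v *)
From mathcomp Require Import all_boot.
From mathcomp Require Import boolp classical_sets functions cardinality.

Set Implicit Arguments.
Unset Strict Implicit.
Unset Printing Implicit Defensive.

Local Open Scope classical_set_scope.
Local Open Scope card_scope.

(* In [X + X], [inl x] stands for the upper vertex x and [inr x] for the lower
   vertex x'. *)
Record partition_monoid (X : Type) := PartitionMonoid {
  blocks : set (set (X + X)) ;
  blocksP : partition blocks id [set: X + X] }.

Lemma partition_monoid_eq X (a b : partition_monoid X) :
  blocks a = blocks b -> a = b.
Proof.
by case: a b => [A hA] [B hB] /= eAB; subst B; congr PartitionMonoid; exact: Prop_irrelevance.
Qed.

Section EquivalenceClasses.
Variables (X : Type) (r : X + X -> X + X -> Prop).
Hypotheses (r_refl : forall u, r u u) (r_sym : forall u v, r u v -> r v u).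
Hypothesis r_trans : forall u v w, r u v -> r v w -> r u w.

Lemma classes_partition : partition (range r) id [set: X + X].
Proof.
split.
- rewrite -subTset => u _; exists (r u); [by exists u | exact: r_refl].
- move=> _ _ [u _ <-] [v _ <-] [w [/= ruw rvw]]; rewrite predeqE => z.
  split => h.
  + by apply: r_trans rvw _; apply: r_trans (r_sym ruw) h.
  + by apply: r_trans ruw _; apply: r_trans (r_sym rvw) h.
- by move=> _ [u _ <-]; exists u; exact: r_refl.
Qed.

Definition classes := PartitionMonoid classes_partition.
End EquivalenceClasses.

(* The vertices x, x'' and x' of the product graph, in this order. *)
Inductive vertex (X : Type) := Up of X | Mid of X | Low of X.

Section Product.
Variable X : Type.
Implicit Types (a b : partition_monoid X).

Definition left_vertex (u : X + X) : vertex X :=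
  match u with inl x => Up x | inr x => Mid x end.
Definition right_vertex (u : X + X) : vertex X :=
  match u with inl x => Mid x | inr x => Low x end.
Definition outer_vertex (u : X + X) : vertex X :=
  match u with inl x => Up x | inr x => Low x end.

(* A block is represented by the complete graph on its vertices. *)
Definition edge a b (p q : vertex X) : Prop :=
  (exists2 B, blocks a B & (left_vertex @` B) p /\ (left_vertex @` B) q) \/
  (exists2 B, blocks b B & (right_vertex @` B) p /\ (right_vertex @` B) q).

Definition joined a b (p q : vertex X) : Prop :=
  exists2 s : seq (vertex X), path (fun p q => `[< edge a b p q >]) p s
    & last p s = q.

Lemma edge_sym a b p q : edge a b p q -> edge a b q p.
Proof. by case=> -[B aB [Bp Bq]]; [left | right]; exists B. Qed.

Lemma joined_refl a b p : joined a b p p.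
Proof. by exists [::]. Qed.

Lemma joined_sym a b p q : joined a b p q -> joined a b q p.
Proof.
case=> s ps <-; exists (rev (belast p s)).
- rewrite rev_path; apply: sub_path ps => u v /asboolP uv.
  by apply/asboolP; exact: edge_sym.
- by case: s {ps} => //= q' s; rewrite rev_cons last_rcons.
Qed.

Lemma joined_trans a b p q r : joined a b p q -> joined a b q r -> joined a b p r.
Proof.
case=> s ps <- [t pt <-]; exists (s ++ t); last by rewrite last_cat.
by rewrite cat_path ps pt.
Qed.

Definition mulp a b : partition_monoid X :=
  @classes X (fun u v => joined a b (outer_vertex u) (outer_vertex v))
    (fun u => @joined_refl a b _)
    (fun u v => @joined_sym a b _ _)
    (fun u v w => @joined_trans a b _ _ _).

Definition column (u : X + X) : X := match u with inl x => x | inr x => x end.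

Definition onep : partition_monoid X :=
  @classes X (fun u v => column u = column v)
    (fun u => erefl) (fun u v => @esym _ _ _) (fun u v w => @etrans _ _ _ _).

Definition units : set (partition_monoid X) :=
  [set a | exists b, mulp a b = onep /\ mulp b a = onep].

Definition subsemigroup (S : set (partition_monoid X)) : Prop :=
  forall a b, S a -> S b -> S (mulp a b).

Definition generated (T : set (partition_monoid X)) : set (partition_monoid X) :=
  smallest subsemigroup T.

End Product.

Section BlockSizes.
Variable X : Type.
Implicit Types (a : partition_monoid X) (B : set (X + X)).

Definition upper B : set X := inl @^-1` B.
Definition lower B : set X := inr @^-1` B.

Definition setL : set (partition_monoid X) :=
  [set a | (forall x, exists2 B, blocks a B & upper B x /\ lower B !=set0) /\
           (forall B x y, blocks a B -> upper B x -> upper B y -> x = y)].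

Definition setR : set (partition_monoid X) :=
  [set a | (forall x, exists2 B, blocks a B & lower B x /\ upper B !=set0) /\
           (forall B x y, blocks a B -> lower B x -> lower B y -> x = y)].

Definition transversal B : Prop := upper B !=set0 /\ lower B !=set0.

(* The parameters are sets of blocks, to be compared up to equinumerosity; the
   threshold mu is given by any set [M] of cardinality mu. *)
Section Threshold.
Variables (U : Type) (a : partition_monoid X) (M : set U).

Definition k_set : set (set (X + X)) :=
  [set B | [/\ blocks a B, transversal B & M #<= upper B]].
Definition kstar_set : set (set (X + X)) :=
  [set B | [/\ blocks a B, transversal B & M #<= lower B]].
Definition d_set : set (set (X + X)) :=
  [set B | [/\ blocks a B, lower B = set0 & M #<= upper B]].
Definition dstar_set : set (set (X + X)) :=
  [set B | [/\ blocks a B, upper B = set0 & M #<= lower B]].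
End Threshold.

End BlockSizes.

(* A set whose cardinality is |A| + |B|. *)
Definition disjoint_sum (T U : Type) (A : set T) (B : set U) : set (T + U) :=
  (inl @` A) `|` (inr @` B).

Definition card_lt (T U : Type) (A : set T) (B : set U) : Prop :=
  A #<= B /\ ~ (B #<= A).

(* An infinite cardinal is regular if it is not a union of fewer sets, all of
   smaller cardinality. *)
Definition regular (T : Type) : Prop :=
  infinite_set [set: T] /\
  forall (I : Type) (D : set I) (F : I -> set T),
    card_lt D [set: T] -> (forall i, D i -> card_lt (F i) [set: T]) ->
    \bigcup_(i in D) F i <> [set: T].

(* Main.v *)
(* Sufficiency.  Replacing [a] in L by a suitable [a * f * a], and dually for [b] in R,
   one may assume that [a] has |X| lower nontransversal blocks of size at least 2
   and [b] has |X| upper nontransversal blocks of size |X|.  Then every [c] is of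
   the form [a * f * b] for a permutation [f].

   Necessity.  Each condition is forced by a proper subsemigroup containing the
   units: the elements of R together with those outside L; the elements with fewer
   than |X| lower nontransversal blocks; those with fewer than |X| lower parts of
   size at least 2; and those with fewer than |X| lower and fewer than |X| upper
   parts of size |X|.  Closure of the last one under products needs |X| to be regular
   and uncountable: a connected component with |X| vertices then has a vertex of
   degree |X|.

   The anti-involution exchanging X and X' takes care of the other half of each
   argument. *)
From Stdlib Require Wellfounded.
Require Import Defs.
From mathcomp Require Import all_boot.
From mathcomp Require Import boolp classical_sets functions cardinality wochoice.

Set Implicit Arguments.
Unset Strict Implicit.
Unset Printing Implicit Defensive.

Local Open Scope classical_set_scope.
Local Open Scope card_scope.

(** * Regular cardinals *)

Lemma card_leTP X T (A : set T) :
  [set: X] #<= A <-> exists2 f : X -> T, injective f & forall x, A (f x).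
Proof.
split=> [/card_leP[f]|[f finj Af]].
  exists (fun x => set_val (f (SigSub (mem_setT x)))) => [x y /val_inj fxy|x].
    by have [] : SigSub (mem_setT x) = SigSub (mem_setT y)
      by apply: (@inj _ _ setT f); rewrite ?in_setT.
  exact: set_valP.
rewrite -(card_le_eql (inj_card_eq (in2W finj))).
by apply: subset_card_le => _ [x _ <-]; exact: Af.
Qed.

(* This is |A| < |X| by comparability of cardinals. *)
Definition small X T (A : set T) : Prop := ~ ([set: X] #<= A).

(** The strict part of the reflexive well-order given by [well_ordering_principle]; minima of
    two-element sets supply antisymmetry and totality. *)
Lemma well_order_exists X : exists lt : X -> X -> Prop,
  well_founded lt /\ forall x y, [\/ lt x y, x = y | lt y x].
Proof.
have [R wR] := well_ordering_principle {classic X}.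
have minR (A : set X) : A !=set0 -> exists2 z, A z & forall x, A x -> R z x.
  move=> [x Ax]; have [|z [[zA Rz] _]] := wR (mem A); first by exists x; exact/mem_set.
  by exists z => [|y Ay]; [exact: set_mem | exact/Rz/mem_set].
have Rxx u : R u u.
  by have [_ -> /(_ u erefl)] := minR [set u] (ex_intro _ u erefl).
have Ranti u v : R u v -> R v u -> u = v.
  move=> Ruv Rvu; have [w [_ wmin]] : exists! w, minimum_of R (mem [set u; v]) w.
    by apply: wR; exists u; apply/mem_set; left.
  have uvE t : t \in mem [set u; v] -> t = u \/ t = v by move/set_mem.
  rewrite -(wmin u) ?(wmin v) //; split=> [|t /uvE[]->] //; apply/mem_set; first by right.
  by left.
exists (fun x y => R x y /\ x <> y); split=> [x|x y].
  apply: contrapT => nAx.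
  have [z nAz Rz] := minR [set x | ~ Acc (fun x y => R x y /\ x <> y) x] (ex_intro _ x nAx).
  apply: nAz; constructor => y [Ryz nyz]; apply: contrapT => /Rz Rzy.
  exact/nyz/Ranti.
have [-> | nxy] := pselect (x = y); first exact: Or32.
have [z [] -> zmin] := minR [set x; y] (ex_intro _ x (or_introl erefl)).
  by apply: Or31; split=> //; apply: zmin; right.
by apply: Or33; split=> [|/esym//]; apply: zmin; left.
Qed.

(** This is the passage to an initial ordinal. If some initial segment is as large as [X], take the
    least [b] bounding such a segment and pull the order back along an injection of [X] below
    [b]. *)
Lemma well_order_initial X : exists lt : X -> X -> Prop,
  [/\ well_founded lt, forall x y, [\/ lt x y, x = y | lt y x] &
      forall x, small X [set y | lt y x]].
Proof.
have [lt [wf_lt tri]] := well_order_exists X.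
have [lt_small|/existsNP[b0 /contrapT big]] :=
    pselect (forall x, small X [set y | lt y x]); first by exists lt.
have [b {big}/card_leTP[j jinj ltj] bmin] : exists2 b, [set: X] #<= [set y | lt y b] &
    forall c, lt c b -> small X [set y | lt y c].
  elim: (wf_lt b0) big => b _ IH big.
  have [bmin|/existsNP[c /not_implyP[ltcb /contrapT]]] := pselect
    (forall c, lt c b -> small X [set y | lt y c]); first by exists b.
  exact: IH.
exists (fun x y => lt (j x) (j y)); split=> [|x y|x /card_leTP[f finj fx]].
- exact: Wellfounded.Inverse_Image.wf_inverse_image.
- by case: (tri (j x) (j y)) => [|/jinj|]; [exact: Or31|exact: Or32|exact: Or33].
- apply: (bmin _ (ltj x)); apply/card_leTP; exists (j \o f) => //; exact: inj_comp.
Qed.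

Section Regular.
Variable X : Type.
Hypothesis X_regular : regular X.

(** An injection of [X] into the union would exhibit [X] as the union of the preimages of the [F i],
    against regularity. *)
Lemma regular_bigcup I T (D : set I) (F : I -> set T) :
  D #<= [set: X] -> small X D -> (forall i, D i -> small X (F i)) ->
  small X (\bigcup_(i in D) F i).
Proof.
move=> leDX ltDX ltF /card_leTP[f finj fD].
apply: (X_regular.2 I D (fun i => f @^-1` F i)) => // [i Di|].
  split; first exact: card_leT.
  move=> /card_leTP[h hinj hF]; apply: (ltF i Di); apply/card_leTP.
  by exists (f \o h) => //; exact: inj_comp.
by rewrite -subTset => x _; have [i Di Fi] := fD x; exists i.
Qed.

Lemma regular_point : X.
Proof. by have [x _] := cid (infinite_setN0 X_regular.1). Qed.

Lemma countable_le_regular T (A : set T) : countable A -> A #<= [set: X].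
Proof. by move=> Ac; apply: card_le_trans Ac _; exact/infiniteP/(X_regular.1). Qed.

Lemma regular_not_finite T (A : set T) : finite_set A -> small X A.
Proof. by move=> Afin /card_le_finite /(_ Afin); exact: X_regular.1. Qed.

Lemma regular_setU T (A B : set T) :
  small X A -> small X B -> small X (A `|` B).
Proof.
move=> ltA ltB.
have -> : A `|` B = \bigcup_(b in [set: bool]) if b then A else B.
  by apply/seteqP; split=> x; [case; [exists true | exists false] | case=> -[]; [left|right]].
apply: regular_bigcup => [||[]//].
  exact/countable_le_regular/countableP.
exact/regular_not_finite/finite_finset.
Qed.

(** Transfinite recursion: [g p] is a point of [X] not taken by any predecessor of [p], and such a
    point exists because the predecessors are fewer than |X|. *)
Lemma regular_wf_card_le T (R : T -> T -> Prop) : well_founded R ->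
  (forall p q, [\/ R p q, p = q | R q p]) ->
  (forall p, small X [set q | R q p]) -> [set: T] #<= [set: X].
Proof.
move=> wfR tri ltR.
pose pick (A : set X) := if pselect (A !=set0) is left e then projT1 (cid e) else regular_point.
have pickP A : A !=set0 -> A (pick A).
  by rewrite /pick; case: pselect => // e _; case: cid.
pose body p (rec : forall q, R q p -> X) := pick [set x | forall q (h : R q p), rec q h <> x].
pose g := Fix wfR (fun=> X) body.
have gE p : g p = pick [set x | forall q, R q p -> g q <> x].
  rewrite /g Fix_eq // => q f f' ff'; congr (body q _).
  by apply: functional_extensionality_dep => r; apply: functional_extensionality_dep => h.
have gP p q : R q p -> g q <> g p.
  rewrite [g p]gE; apply: (pickP [set x | forall q, R q p -> g q <> x]) q.
  (* If no value were free, [g] would map the predecessors of [p] onto [X]. *)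
  apply: contrapT => /set0P/negP/negPn/eqP e.
  apply: (ltR p); apply: card_le_trans (card_image_le g [set q | R q p]).
  apply: subset_card_le => x _; apply: contrapT => nx; have : set0 x; last by [].
  by rewrite -e => q qp gx; apply: nx; exists q.
apply/card_leTP; exists g => // p q gpq.
by case: (tri p q) => // /gP; rewrite gpq.
Qed.

(** A variant of Gödel's ordering of pairs: compare a common bound [m p] of the two coordinates
    first, then break ties by an arbitrary well-order [lt2]. Initial segments are unions of few
    subsets of small squares, hence small by regularity. *)
Lemma regular_prod : [set: X * X] #<= [set: X].
Proof.
have [lt [wf_lt tri lt_small]] := well_order_initial X.
have [lt2 [wf_lt2 tri2]] := well_order_exists (X * X).
have le_small c : small X [set a | lt a c \/ a = c].
  exact: (regular_setU (@lt_small c) (regular_not_finite (finite_set1 c))).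
have [m mP] : {m : X * X -> X & forall p,
    (lt p.1 (m p) \/ p.1 = m p) /\ (lt p.2 (m p) \/ p.2 = m p)}.
  apply: (@choice _ _ (fun p c => (lt p.1 c \/ p.1 = c) /\ (lt p.2 c \/ p.2 = c))).
  by move=> [a b]; case: (tri a b) => /= h; [exists b | exists a | exists a]; auto.
have small2 c : small X [set p | (lt p.1 c \/ p.1 = c) /\ (lt p.2 c \/ p.2 = c)].
  have -> : [set p | (lt p.1 c \/ p.1 = c) /\ (lt p.2 c \/ p.2 = c)] =
      \bigcup_(a in [set a | lt a c \/ a = c]) (pair a @` [set a | lt a c \/ a = c]).
    apply/seteqP; split=> [[a b] [/= ha hb]|_ [a ha [b hb <-]]] //.
    by exists a => //; exists b.
  apply: regular_bigcup => [|//|a _]; first exact: card_leT.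
  move=> h; apply: (le_small c); exact: card_le_trans h (card_image_le _ _).
pose R p q := lt (m p) (m q) \/ m p = m q /\ lt2 p q.
apply: (@regular_wf_card_le _ R) => [p|p q|p].
- suff H c q : m q = c -> Acc R q by exact: (H (m p)).
  elim: (wf_lt c) q => {}c _ IHc q; elim: (wf_lt2 q) => {}q _ IHq mq.
  constructor=> r [rq|[rq]]; last by move/IHq; apply; rewrite rq.
  by apply: IHc erefl; rewrite -mq.
- case: (tri (m p) (m q)) => [?|e|?]; [by apply: Or31; left| |by apply: Or33; left].
  by case: (tri2 p q) => ?; [apply: Or31|apply: Or32|apply: Or33] => //; right.
- have -> : [set q | R q p] = \bigcup_(c in [set c | lt c (m p) \/ c = m p])
      ([set q | R q p] `&` [set q | m q = c]).
    apply/seteqP; split=> [q Rqp|q [c _ []//]].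
    by exists (m q) => //; case: Rqp => [|[]]; [left|right].
  apply: regular_bigcup => [|//|c _]; first exact: card_leT.
  move=> h; apply: (small2 c); apply: card_le_trans h _; apply: subset_card_le.
  by move=> q [_ <-]; exact: mP.
Qed.

Lemma regular_sum : [set: X + X] #<= [set: X].
Proof.
apply: card_le_trans regular_prod.
have [x [y xy]] : exists x y : X, x <> y.
  apply: contrapT => nxy; apply: X_regular.1; apply: (sub_finite_set _ (finite_set1 regular_point)).
  by move=> x _; apply: contrapT => nx; apply: nxy; exists x, regular_point.
apply/card_leTP; exists (fun u => match u with inl z => (x, z) | inr z => (y, z) end) => //.
by move=> [a|a] [b|b] [] => [->|e _|e _|->] //; case: xy.
Qed.

End Regular.

Lemma large_card_eq X (A : set X) : [set: X] #<= A -> A #= [set: X].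
Proof. by rewrite card_eq_le card_leT. Qed.

(** Bijections between corresponding fibres are glued together. Later permutations of [X] are all
    obtained this way, by prescribing labels on both sides. *)
Lemma fiberwise_bijection X Y K (l : X -> K) (r : Y -> K) :
  (forall k, l @^-1` [set k] #= r @^-1` [set k]) ->
  exists f : X -> Y, exists2 g : Y -> X,
    cancel f g /\ cancel g f & forall x, r (f x) = l x.
Proof.
move=> lr.
have bij_f k : exists f : l @^-1` [set k] -> r @^-1` [set k], bijective f by exact/card_bijP/lr.
pose f k := sval (cid (bij_f k)).
have inv_f k : exists g, cancel (f k) g /\ cancel g (f k).
  by have [g] := svalP (cid (bij_f k)); exists g.
pose g k := sval (cid (inv_f k)).
have gP k : cancel (f k) (g k) /\ cancel (g k) (f k) by exact: svalP (cid (inv_f k)).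
have lmem x : x \in l @^-1` [set l x] by exact/mem_set.
have rmem x : x \in r @^-1` [set r x] by exact/mem_set.
pose F x := set_val (f (l x) (SigSub (lmem x))).
pose G y := set_val (g (r y) (SigSub (rmem y))).
have rF x : r (F x) = l x := set_valP (f (l x) (SigSub (lmem x))).
have lG y : l (G y) = r y := set_valP (g (r y) (SigSub (rmem y))).
exists F, G => //; split=> [x|y].
  (* The membership proof is generalised so that the fibre index [r (F x)] can be rewritten to
     [l x]. *)
  rewrite /G; move: (rmem (F x)); rewrite rF => h.
  suff -> : SigSub h = f (l x) (SigSub (lmem x)) by rewrite (gP _).1.
  exact: val_inj.
rewrite /F; move: (lmem (G y)); rewrite lG => h.
suff -> : SigSub h = g (r y) (SigSub (rmem y)) by rewrite (gP _).2.
exact: val_inj.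
Qed.

(** * Partitions as equivalence relations *)

Definition same X (a : partition_monoid X) u v : Prop :=
  exists2 B, blocks a B & B u /\ B v.

Definition block X (a : partition_monoid X) u : set (X + X) := [set v | same a u v].

Section Blocks.
Variable X : Type.
Implicit Types (a b : partition_monoid X) (u v w : X + X) (p q : vertex X).

Lemma blockE a B u : blocks a B -> B u -> B = block a u.
Proof.
have [_ triv _] := blocksP a => aB Bu; apply/seteqP; split=> v; first by exists B.
by case=> C aC [Cu Cv]; rewrite (triv B C) //; exists u.
Qed.

Lemma same_refl a u : same a u u.
Proof.
have [cov _ _] := blocksP a; have : [set: X + X] u by [].
by rewrite -cov => -[B aB Bu]; exists B.
Qed.

Lemma blocks_block a u : blocks a (block a u).
Proof. by have [B aB [Bu _]] := same_refl a u; rewrite -(blockE aB Bu). Qed.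

Lemma blocks_inv a B : blocks a B -> exists u, B = block a u.
Proof.
move=> aB; have [_ _ /(_ B aB)[u Bu]] := blocksP a.
by exists u; exact: blockE.
Qed.

Lemma same_sym a u v : same a u v -> same a v u.
Proof. by case=> B aB [Bu Bv]; exists B. Qed.

Lemma same_trans a u v w : same a u v -> same a v w -> same a u w.
Proof.
move=> [B aB [Bu Bv]] vw; exists B => //; split=> //.
by rewrite (blockE aB Bv).
Qed.

Lemma eq_block a u v : same a u v -> block a u = block a v.
Proof.
move=> uv; apply/seteqP; split=> w; [exact: same_trans (same_sym uv)|exact: same_trans].
Qed.

Lemma eq_blockP a u v : block a u = block a v <-> same a u v.
Proof.
split=> [e|/eq_block//]; have : block a v v := same_refl a v.
by rewrite -e.
Qed.

Lemma same_ext a b : (forall u v, same a u v <-> same b u v) -> a = b.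
Proof.
move=> ab; have eab u : block a u = block b u by apply/seteqP; split=> v /ab.
apply: partition_monoid_eq; apply/seteqP; split=> B /blocks_inv[u ->].
  by rewrite eab; exact: blocks_block.
by rewrite -eab; exact: blocks_block.
Qed.

Lemma same_classes (r : X + X -> X + X -> Prop) r_refl r_sym r_trans u v :
  same (@classes X r r_refl r_sym r_trans) u v <-> r u v.
Proof.
split=> [[_ [w _ <-] [wu wv]]|uv]; first exact: r_trans (r_sym _ _ wu) wv.
by exists (r u); [exists u | split].
Qed.

Lemma same_mulp a b u v :
  same (mulp a b) u v <-> joined a b (outer_vertex u) (outer_vertex v).
Proof. exact: same_classes. Qed.

Lemma edge_left a b u v : same a u v -> edge a b (left_vertex u) (left_vertex v).
Proof. by case=> B aB [Bu Bv]; left; exists B. Qed.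

Lemma edge_right a b u v : same b u v -> edge a b (right_vertex u) (right_vertex v).
Proof. by case=> B bB [Bu Bv]; right; exists B. Qed.

Lemma edge_joined a b p q : edge a b p q -> joined a b p q.
Proof. by move=> pq; exists [:: q] => //=; rewrite andbT; exact/asboolP. Qed.

Lemma joined_left a b u v : same a u v -> joined a b (left_vertex u) (left_vertex v).
Proof. by move=> uv; exact/edge_joined/edge_left. Qed.

Lemma joined_right a b u v : same b u v -> joined a b (right_vertex u) (right_vertex v).
Proof. by move=> uv; exact/edge_joined/edge_right. Qed.

(** The tool for bounding a component from above: [E] is an explicit set of vertices, and it
    suffices that no block of either factor leads out of it. *)
Lemma joined_ind a b (E : set (vertex X)) :
  (forall u v, same a u v -> E (left_vertex u) -> E (left_vertex v)) ->
  (forall u v, same b u v -> E (right_vertex u) -> E (right_vertex v)) ->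
  forall p q, joined a b p q -> E p -> E q.
Proof.
move=> Ea Eb p q [s + <-]; elim: s p => //= r s IHs p /andP[/asboolP pr rs] Ep.
apply: (IHs r) => //; case: pr Ep => -[B aB [[u Bu <-] [v Bv <-]]].
  by apply: Ea; exists B.
by apply: Eb; exists B.
Qed.

Lemma joined_label a b K (f : vertex X -> K) :
  (forall u v, same a u v -> f (left_vertex u) = f (left_vertex v)) ->
  (forall u v, same b u v -> f (right_vertex u) = f (right_vertex v)) ->
  forall p q, joined a b p q -> f p = f q.
Proof.
move=> fa fb p q pq; apply: (joined_ind (E := [set r | f p = f r]) _ _ pq) => // u v uv /= ->.
  exact: fa.
exact: fb.
Qed.

Lemma same_onep u v : same (onep X) u v <-> column u = column v.
Proof. exact: same_classes. Qed.

Section Kernel.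
Variables (K : Type) (key : X + X -> K).

Definition kerp : partition_monoid X :=
  @classes X (fun u v => key u = key v)
    (fun u => erefl) (fun u v => @esym _ _ _) (fun u v w => @etrans _ _ _ _).

Lemma same_kerp u v : same kerp u v <-> key u = key v.
Proof. exact: same_classes. Qed.
End Kernel.

(** The upper vertex [x] gets the key of the lower vertex [f x], so for bijective [f] this is the
    unit with blocks {x, (f x)'}. *)
Definition permp (f : X -> X) :=
  kerp (fun u => match u with inl x => f x | inr y => y end).

Definition map_lower (f : X -> X) u :=
  match u with inl x => inl x | inr y => inr (f y) end.

Lemma same_mulp_perm a f g u v : cancel f g -> cancel g f ->
  same (mulp a (permp f)) u v <-> same a (map_lower g u) (map_lower g v).
Proof.
move=> fK gK; rewrite same_mulp; split=> uv.
  (* [unfold] contracts the blocks of the permutation, which retracts the product graph onto the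
     vertices of [a]. *)
  pose unfold p := match p with Up x => inl x | Mid z => inr z | Low y => inr (g y) end.
  have outE w : unfold (outer_vertex w) = map_lower g w by case: w.
  rewrite -!outE; apply: (joined_ind (E := [set p | same a (unfold (outer_vertex u)) (unfold p)])
    _ _ uv) => [s t st|s t /same_kerp st|] /=; last exact: same_refl.
    have leftE w : unfold (left_vertex w) = w by case: w.
    by rewrite !leftE => /same_trans; apply.
  have rightE w : unfold (right_vertex w) = inr (g match w with inl x => f x | inr y => y end).
    by case: w => //= x; rewrite fK.
  by rewrite !rightE st.
have outE w : joined a (permp f) (outer_vertex w) (left_vertex (map_lower g w)).
  case: w => [x|y]; first exact: joined_refl.
  by apply: (@joined_right _ _ (inr y) (inl (g y))); apply/same_kerp; rewrite gK.
apply: joined_trans (outE u) (joined_trans (joined_left _ uv) (joined_sym (outE v))).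
Qed.

Lemma permp_unit f g : cancel f g -> cancel g f -> units (permp f).
Proof.
have permpV h k : cancel h k -> cancel k h -> mulp (permp h) (permp k) = onep X.
  move=> hK kK; apply: same_ext => u v.
  rewrite (same_mulp_perm _ _ _ kK hK) same_kerp same_onep.
  have E w : match map_lower h w with inl x => h x | inr y => y end = h (column w) by case: w.
  by rewrite !E; split=> [/(can_inj hK)|->].
by exists (permp g); split; exact: permpV.
Qed.

(** * The anti-involution and the classes L and R *)

Definition swap u : X + X := match u with inl x => inr x | inr x => inl x end.

Lemma swapK : involutive swap. Proof. by case. Qed.

Definition dualp a : partition_monoid X :=
  @classes X (fun u v => same a (swap u) (swap v)) (fun u => same_refl a _)
    (fun u v => @same_sym a _ _) (fun u v w => @same_trans a _ _ _).

Lemma same_dualp a u v : same (dualp a) u v <-> same a (swap u) (swap v).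
Proof. exact: same_classes. Qed.

Lemma dualpK : involutive dualp.
Proof. by move=> a; apply: same_ext => u v; rewrite !same_dualp !swapK. Qed.

Lemma dualp_mulp a b : dualp (mulp a b) = mulp (dualp b) (dualp a).
Proof.
(* Turning the product graph upside down exchanges the roles of the two factors. *)
pose flip p := match p with Up x => Low x | Mid x => Mid x | Low x => Up x end.
have sub c d (u v : vertex X) : joined c d u v ->
    joined (dualp d) (dualp c) (flip u) (flip v).
  move=> uv; apply: (joined_ind (E := [set p | joined (dualp d) (dualp c) (flip u) (flip p)]) _ _ uv);
    last exact: joined_refl.
    move=> s t st /joined_trans; apply.
    have E w : flip (left_vertex w) = right_vertex (swap w) by case: w.
    by rewrite !E; apply: joined_right; rewrite same_dualp !swapK.
  move=> s t st /joined_trans; apply.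
  have E w : flip (right_vertex w) = left_vertex (swap w) by case: w.
  by rewrite !E; apply: joined_left; rewrite same_dualp !swapK.
have E w : flip (outer_vertex w) = outer_vertex (swap w) by case: w.
apply: same_ext => u v; rewrite same_dualp !same_mulp; split=> /sub.
  by rewrite !E !swapK.
by rewrite !E !dualpK.
Qed.

Lemma dualp_onep : dualp (onep X) = onep X.
Proof. by apply: same_ext => u v; rewrite same_dualp !same_onep; case: u v => [?|?] [?|?]. Qed.

Lemma dualp_units a : units a -> units (dualp a).
Proof.
by case=> b [ab ba]; exists (dualp b); rewrite -!dualp_mulp ab ba dualp_onep.
Qed.

Lemma blocks_dualp a B : blocks (dualp a) B <-> blocks a (swap @^-1` B).
Proof.
have E u : swap @^-1` block (dualp a) u = block a (swap u).
  by apply/seteqP; split=> v; rewrite /block /= same_dualp swapK.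
have K C : swap @^-1` (swap @^-1` C) = C by apply/seteqP; split=> v /=; rewrite swapK.
split=> [/blocks_inv[u ->]|/blocks_inv[u eB]]; first by rewrite E; exact: blocks_block.
by rewrite -(K B) eB -(swapK u) -E K; exact: blocks_block.
Qed.

Lemma setLP a : setL a <-> (forall x, exists y, same a (inl x) (inr y)) /\
  (forall x y, same a (inl x) (inl y) -> x = y).
Proof.
split=> -[a1 a2]; split.
- by move=> x; have [B aB [Bx [y By]]] := a1 x; exists y, B.
- by move=> x y [B aB [Bx By]]; exact: a2 By.
- by move=> x; have [y [B aB [Bx By]]] := a1 x; exists B => //; split=> //; exists y.
- by move=> B x y aB Bx By; apply: a2; exists B.
Qed.

(** From here on membership in R is expressed as [setL] of the dual, so that each argument is made
    for one side only. *)
Lemma setR_dualp a : setR a <-> setL (dualp a).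
Proof.
rewrite setLP; split=> -[a1 a2]; split.
- by move=> x; have [B aB [Bx [y By]]] := a1 x; exists y; apply/same_dualp; exists B.
- by move=> x y /same_dualp[B aB [Bx By]]; exact: a2 By.
- move=> x; have [y /same_dualp[B aB [Bx By]]] := a1 x.
  by exists B => //; split=> //; exists y.
- by move=> B x y aB Bx By; apply: a2; apply/same_dualp; exists B.
Qed.

Lemma setL_mulp a b : setL a -> setL b -> setL (mulp a b).
Proof.
move=> /setLP[a1 a2] /setLP[b1 b2]; apply/setLP; split=> [x|x y /same_mulp xy].
  have [z xz] := a1 x; have [y zy] := b1 z; exists y; apply/same_mulp.
  exact: joined_trans (joined_left b xz) (joined_right a zy).
(* Distinct upper vertices of [b] are never joined inside [b], so a path from [Up x] that enters [b]
   can only come back through the same middle vertex; hence it stays with the [a]-block of [x]. *)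
apply: a2; pose E := [set p | match p with Up x' => same a (inl x) (inl x')
  | Mid z => same a (inl x) (inr z)
  | Low y => exists2 z, same b (inl z) (inr y) & same a (inl x) (inr z) end].
apply: (joined_ind (E := E) _ _ xy) => [u v uv|u v uv|] /=; last exact: same_refl.
  by case: u v uv => [s|s] [t|t] st /= /same_trans; apply.
case: u v uv => [s|s] [t|t] st /=.
- by rewrite (b2 _ _ st).
- by exists s.
- by case=> z zs xz; rewrite -(b2 z t) //; exact: same_trans st.
- by case=> z zs xz; exists z => //; exact: same_trans st.
Qed.

Lemma setL_mulpl a b : setL (mulp a b) -> setL a.
Proof.
move=> /setLP[ab1 ab2]; apply/setLP; split=> [x|x y xy]; last first.
  by apply: ab2; apply/same_mulp; exact: joined_left xy.
apply: contrapT => nx; have [y /same_mulp] := ab1 x.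
(* If the [a]-block of [x] has no lower vertex, the component of [Up x] never leaves the upper
   row. *)
pose E := [set p | if p is Up x' then same a (inl x) (inl x') else False].
move/(joined_ind (E := E)); apply=> [[s|s] [t|t] st //=|[s|s] [t|t] st //=|].
- by move/same_trans; apply.
- by move=> xs; apply: nx; exists t; exact: same_trans st.
- exact: same_refl.
Qed.

End Blocks.

Section PermDual.
Variable X : Type.
Implicit Types a b : partition_monoid X.

Definition map_upper (f : X -> X) (u : X + X) : X + X :=
  match u with inl x => inl (f x) | inr y => inr y end.

Lemma dualp_permp (f g : X -> X) : cancel f g -> cancel g f -> dualp (permp f) = permp g.
Proof.
move=> fK gK; apply: same_ext => u v; rewrite same_dualp !same_kerp.
have E w : match w with inl x => g x | inr y => y end =
    g match swap w with inl x => f x | inr y => y end by case: w => //= x; rewrite fK.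
by rewrite !E; split=> [->|/(can_inj gK)].
Qed.

Lemma same_perm_mulp b (f g : X -> X) u v : cancel f g -> cancel g f ->
  same (mulp (permp f) b) u v <-> same b (map_upper f u) (map_upper f v).
Proof.
move=> fK gK; rewrite -[mulp _ _]dualpK dualp_mulp (dualp_permp fK gK) same_dualp.
rewrite (same_mulp_perm _ _ _ gK fK) same_dualp.
have E w : swap (map_lower f (swap w)) = map_upper f w by case: w.
by rewrite !E.
Qed.

(** Membership in both L and R leaves exactly one upper and one lower vertex in each block, and
    matching them gives mutually inverse maps. *)
Lemma setL_dualp_perm a : setL a -> setL (dualp a) ->
  exists f g : X -> X, [/\ cancel f g, cancel g f & a = permp f].
Proof.
move=> /setLP[a1 a2] /setLP[d1 d2].
have [f fP] := choice a1; have [g gP] := choice d1.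
have {}gP y : same a (inl (g y)) (inr y) by have /same_dualp := gP y; exact: same_sym.
have {}d2 x y : same a (inr x) (inr y) -> x = y by move=> xy; apply: d2; exact/same_dualp.
exists f, g; split=> [x|y|].
- by apply: a2; apply: same_trans (gP _) (same_sym (fP x)).
- by apply: d2; apply: same_trans (same_sym (fP _)) (gP y).
apply: same_ext => u v; rewrite same_kerp.
have keyP w : same a w (inr match w with inl x => f x | inr y => y end).
  by case: w => [x|y]; [exact: fP|exact: same_refl].
split=> [uv|euv].
  by apply: d2; apply: same_trans (same_sym (keyP u)) (same_trans uv (keyP v)).
by apply: same_trans (keyP u) _; rewrite euv; exact: same_sym.
Qed.

Lemma setL_units a : units a -> setL a.
Proof.
case=> b [ab _]; apply: (@setL_mulpl _ _ b); rewrite ab; apply/setLP; split=> [x|x y].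
  by exists x; exact/same_onep.
by move/same_onep.
Qed.

Lemma setL_mul_perm (f g : X -> X) b : cancel f g -> cancel g f ->
  setL (mulp (permp f) b) -> setL b.
Proof.
move=> fK gK /setLP[fb1 fb2]; apply/setLP; split=> [x|x y xy].
  have [y] := fb1 (g x); rewrite (same_perm_mulp _ _ _ fK gK) /= gK => xy.
  by exists y.
by apply: (can_inj gK); apply: fb2; rewrite (same_perm_mulp _ _ _ fK gK) /= !gK.
Qed.

End PermDual.

(* Its cardinality is [k*(a, |M|) + d*(a, |M|)] when [M] is nonempty. *)
Definition low_set X U (a : partition_monoid X) (M : set U) : set (set (X + X)) :=
  [set B | blocks a B /\ M #<= lower B].

Lemma card_I1_le T (A : set T) : `I_1 #<= A <-> A !=set0.
Proof.
split=> [h|[x Ax]].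
  by apply/set0P; apply: contraTneq h => ->; rewrite card_le0; apply/eqP => /seteqP[/(_ 0 isT)].
rewrite -(card_le_eql (card_set1 (x := x))); apply: subset_card_le => _ ->; exact: Ax.
Qed.

Lemma card_I2_le T (A : set T) : `I_2 #<= A <-> exists x y, [/\ A x, A y & x <> y].
Proof.
split=> [/card_leP[f]|[x [y [Ax Ay xy]]]].
  have i0 : 0 \in `I_2 by exact/mem_set.
  have i1 : 1 \in `I_2 by exact/mem_set.
  exists (set_val (f (SigSub i0))), (set_val (f (SigSub i1))).
  split; [exact: set_valP|exact: set_valP|move/val_inj => e].
  by have [] : SigSub i0 = SigSub i1 by apply: (@inj _ _ setT f); rewrite ?in_setT.
apply: (@card_le_trans _ _ _ ((fun n : nat => if n == 0 then x else y) @` `I_2)); last first.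
  by apply: subset_card_le => _ [[|n] _ <-].
rewrite (card_le_eqr (inj_card_eq _)) //.
move=> [|[|n]] [|[|m]] /set_mem //= _ /set_mem //= _ e; by case: xy.
Qed.

(** * Parameters of products *)

Section ProductParameters.
Variable X : Type.
Hypothesis X_uncountable : ~ countable [set: X].
Hypothesis X_regular : regular X.
Implicit Types a b c : partition_monoid X.

(** Choose for each block in [S] a clique from [W] in its component. Two blocks with the same clique
    are joined, hence equal, so the choice is injective. *)
Lemma small_witness a b (S : set (set (X + X))) (W : set (set (vertex X))) :
  S `<=` blocks (mulp a b) ->
  (forall V p q, W V -> V p -> V q -> joined a b p q) ->
  (forall u, S (block (mulp a b) u) ->
     exists V p, [/\ W V, V p & joined a b p (outer_vertex u)]) ->
  small X W -> small X S.
Proof.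
move=> Sab clique wit smallW /card_leTP[f finj Sf]; apply: smallW.
have {wit} /choice[g gP] x : exists V, W V /\
    exists p u, [/\ V p, f x = block (mulp a b) u & joined a b p (outer_vertex u)].
  have [u fx] := blocks_inv (Sab _ (Sf x)).
  have [|V [p [WV Vp pu]]] := wit u; first by rewrite -fx; exact: Sf.
  by exists V; split=> //; exists p, u.
apply/card_leTP; exists g => [x y gxy|x]; last by have [] := gP x.
have [_ [p [u [gp fx pu]]]] := gP x; have [Wg [q [v [gq fy qv]]]] := gP y.
apply: finj; rewrite fx fy; apply/eq_block/same_mulp.
apply: joined_trans (joined_sym pu) (joined_trans _ qv).
by apply: clique Wg _ _ => //; rewrite -gxy.
Qed.

Definition left_sets (S : set (set (X + X))) : set (set (vertex X)) :=
  [set (@left_vertex X) @` B | B in S].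
Definition right_sets (S : set (set (X + X))) : set (set (vertex X)) :=
  [set (@right_vertex X) @` B | B in S].

Lemma left_clique a b S V p q : S `<=` blocks a ->
  left_sets S V -> V p -> V q -> joined a b p q.
Proof.
by move=> Sa [B /Sa aB <-] [u Bu <-] [v Bv <-]; apply: joined_left; exists B.
Qed.

Lemma right_clique a b S V p q : S `<=` blocks b ->
  right_sets S V -> V p -> V q -> joined a b p q.
Proof.
by move=> Sa [B /Sa aB <-] [u Bu <-] [v Bv <-]; apply: joined_right; exists B.
Qed.

Lemma small_image T U (f : T -> U) (A : set T) : small X A -> small X (f @` A).
Proof. by move=> sA h; apply: sA; exact: card_le_trans h (card_image_le _ _). Qed.

(** The component of a lower nontransversal block contains a lower nontransversal block of [a] or of
    [b]: otherwise one climbs from a lower vertex through [b] to the middle row, then through [a] to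
    the upper row. *)
Lemma small_dstar_mulp a b : small X (dstar_set a `I_1) -> small X (dstar_set b `I_1) ->
  small X (dstar_set (mulp a b) `I_1).
Proof.
move=> sa sb; apply: (@small_witness a b _
  (left_sets (dstar_set a `I_1) `|` right_sets (dstar_set b `I_1))).
- by move=> B [].
- move=> V p q [] h; [apply: left_clique h|apply: right_clique h]; by move=> B [].
- move=> u [_ up0 /card_I1_le[y /same_mulp uy]]; apply: contrapT => nwit.
  have [b0|/set0P[z yz]] := eqVneq (upper (block b (inr y))) set0.
    apply: nwit; exists (@right_vertex X @` block b (inr y)), (Low y); split.
    + right; exists (block b (inr y)) => //; split=> //; first exact: blocks_block.
      by apply/card_I1_le; exists y; exact: same_refl.
    + by exists (inr y) => //; exact: same_refl.
    + exact: joined_sym.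
  have [a0|/set0P[x zx]] := eqVneq (upper (block a (inr z))) set0.
    apply: nwit; exists (@left_vertex X @` block a (inr z)), (Mid z); split.
    + left; exists (block a (inr z)) => //; split=> //; first exact: blocks_block.
      by apply/card_I1_le; exists z; exact: same_refl.
    + by exists (inr z) => //; exact: same_refl.
    + exact: joined_trans (joined_right a (same_sym yz)) (joined_sym uy).
  have : upper (block (mulp a b) u) x.
    apply/same_mulp; apply: joined_trans uy _.
    exact: joined_trans (joined_right a yz) (joined_left b zx).
  by rewrite up0.
- by apply: regular_setU => //; exact: small_image.
Qed.

(** If a component meets no lower part of size at least 2 in [a] or [b], then [a] joins none of its
    middle vertices to another one. Its lower vertices thus lie in a single block of [b], and only
    one is possible. *)
Lemma small_low2_mulp a b : small X (low_set a `I_2) -> small X (low_set b `I_2) ->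
  small X (low_set (mulp a b) `I_2).
Proof.
move=> sa sb; apply: (@small_witness a b _
  (left_sets (low_set a `I_2) `|` right_sets (low_set b `I_2))).
- by move=> B [].
- move=> V p q [] h; [apply: left_clique h|apply: right_clique h]; by move=> B [].
- move=> u [_ /card_I2_le[y [y' [/same_mulp uy /same_mulp uy' yy']]]]; apply: contrapT => nwit.
  have a_low z t : joined a b (Low y) (Mid z) -> same a (inr z) (inr t) -> z = t.
    move=> yz zt; apply: contrapT => nzt; apply: nwit.
    exists (@left_vertex X @` block a (inr z)), (Mid z); split.
    + left; exists (block a (inr z)) => //; split=> //; first exact: blocks_block.
      by apply/card_I2_le; exists z, t; split=> //; exact: same_refl.
    + by exists (inr z) => //; exact: same_refl.
    + exact: joined_sym (joined_trans uy yz).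
  have b_low : ~ same b (inr y) (inr y').
    move=> zt; apply: nwit; exists (@right_vertex X @` block b (inr y)), (Low y); split.
    + right; exists (block b (inr y)) => //; split=> //; first exact: blocks_block.
      by apply/card_I2_le; exists y, y'; split=> //; exact: same_refl.
    + by exists (inr y) => //; exact: same_refl.
    + exact: joined_sym.
  (* The whole component: the [b]-block of [y], with the upper vertices that [a] attaches to it. *)
  pose E := [set p | match p with
    | Up x => exists2 z, same b (inr y) (inl z) & same a (inr z) (inl x)
    | Mid z => same b (inr y) (inl z)
    | Low t => same b (inr y) (inr t) end].
  apply: b_low.
  apply: (joined_ind (E := E) _ _ (joined_trans (joined_sym uy) uy')); last exact: same_refl.
    case=> [s|s] [t|t] st /=.
    + by case=> z yz zs; exists z => //; exact: same_trans st.
    + case=> z yz zs; rewrite -(a_low z t) //; first exact: (joined_right a yz).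
      exact: same_trans st.
    + by move=> ys; exists s.
    + by move=> ys; rewrite -(a_low s t) //; exact: (joined_right a ys).
  by case=> [s|s] [t|t] st /= /same_trans; apply.
- by apply: regular_setU => //; exact: small_image.
Qed.

(* Breadth-first search: each layer of a component all of whose blocks are
   small is small, and there are only countably many layers. *)
Lemma small_component a b y :
  (forall z, joined a b (Low y) (Mid z) -> small X (lower (block a (inr z)))) ->
  (forall u, joined a b (Low y) (right_vertex u) ->
     small X (lower (block b u)) /\ small X (upper (block b u))) ->
  small X [set t | joined a b (Low y) (Low t)].
Proof.
move=> sa sb.
(* Layer 0 holds the middle vertices in the [b]-block of [y]; each further layer takes one step
   through [a] and then one through [b]. *)
pose N := fix N k := if k is k'.+1 then \bigcup_(z in N k')
  \bigcup_(t in lower (block a (inr z))) upper (block b (inl t)) else upper (block b (inr y)).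
have NP k : small X (N k) /\ forall z, N k z -> joined a b (Low y) (Mid z).
  elim: k => [|k [sN jN]] /=.
    split=> [|z yz]; last exact: (joined_right a yz).
    by apply: (sb (inr y) _).2; exact: joined_refl.
  have jt z t : N k z -> lower (block a (inr z)) t -> joined a b (Low y) (Mid t).
    by move=> /jN yz zt; apply: joined_trans yz (joined_left b zt).
  split=> [|w [z Nz [t zt tw]]]; last exact: joined_trans (jt _ _ Nz zt) (joined_right a tw).
  apply: regular_bigcup => // [|z Nz]; first exact: card_leT.
  apply: regular_bigcup => // [||t zt]; [exact: card_leT|exact/sa/jN|].
  by apply: (sb (inl t) _).2; exact: jt Nz zt.
pose Nw := \bigcup_(k in [set: nat]) N k.
have sNw : small X Nw.
  (* Uncountability enters here: it makes the index set of the layers small. *)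
  apply: regular_bigcup => // [|k _]; last by have [] := NP k.
  exact: countable_le_regular (countableP _).
have NwS z t w : Nw z -> same a (inr z) (inr t) -> same b (inl t) (inl w) -> Nw w.
  by move=> [k _ Nz] zt tw; exists k.+1 => //; exists z => //; exists t.
pose E := [set p | match p with
  | Up x => exists2 z, Nw z & same a (inr z) (inl x)
  | Mid z => Nw z
  | Low t => same b (inr y) (inr t) \/ exists2 z, Nw z & same b (inl z) (inr t) end].
have sub : [set t | joined a b (Low y) (Low t)] `<=`
    lower (block b (inr y)) `|` \bigcup_(z in Nw) lower (block b (inl z)).
  move=> t /(joined_ind (E := E)) h.
  have [||| |[z Nz zt]] := h; [| | |by left|by right; exists z].
  - case=> [r|r] [s|s] rs /=.
    + by case=> z Nz zr; exists z => //; exact: same_trans rs.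
    + by case=> z Nz zr; apply: (NwS z s) (same_refl _ _) => //; exact: same_trans rs.
    + by move=> Nr; exists r.
    + by move=> Nr; apply: (NwS r s) (same_refl _ _).
  - case=> [r|r] [s|s] rs /=.
    + by move=> Nr; apply: (NwS r r) rs => //; exact: same_refl.
    + by move=> Nr; right; exists r.
    + case=> [yr|[z Nz zr]]; first by exists 0 => //; exact: same_trans rs.
      by apply: (NwS z z) => //; [exact: same_refl|exact: same_trans rs].
    + case=> [yr|[z Nz zr]]; first by left; exact: same_trans rs.
      by right; exists z => //; exact: same_trans rs.
  - by left; exact: same_refl.
move/card_le_trans => /(_ _ _ (subset_card_le sub)).
apply: regular_setU => //; first by apply: (sb (inr y) _).1; exact: joined_refl.
apply: regular_bigcup => // [|z [k _ Nz]]; first exact: card_leT.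
by apply: (sb (inl z) _).1; have [_] := NP k; exact.
Qed.

(** By [small_component], a component with |X| lower vertices contains a lower part of [a], or a
    lower or upper part of [b], of size |X|. The upper parts of [b] are counted through its dual. *)
Lemma small_low_mulp a b : small X (low_set a [set: X]) ->
  small X (low_set (dualp b) [set: X]) -> small X (low_set b [set: X]) ->
  small X (low_set (mulp a b) [set: X]).
Proof.
pose up := [set B | blocks b B /\ [set: X] #<= upper B].
move=> sa sb' sb.
have sup : small X up.
  have swap2 (B : set (X + X)) : @swap X @^-1` (@swap X @^-1` B) = B.
    by apply/seteqP; split=> v /=; rewrite swapK.
  have := small_image (f := preimage (@swap X)) sb'; apply: contra_not => h.
  apply: card_le_trans h _; apply: subset_card_le => B [bB XB].
  exists (@swap X @^-1` B) => //; split; last by [].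
  by apply/blocks_dualp; rewrite swap2.
apply: (@small_witness a b _
  (left_sets (low_set a [set: X]) `|` right_sets (low_set b [set: X] `|` up))).
- by move=> B [].
- move=> V p q [] h; [apply: left_clique h; by move=> B []|apply: right_clique h].
  by move=> B [] [].
- move=> u [_ XG]; apply: contrapT => nwit.
  have [f finj fG] := (card_leTP _ _).1 XG.
  have [y /same_mulp uy] : lower (block (mulp a b) u) !=set0.
    by exists (f (regular_point X_regular)).
  suff : small X [set t | joined a b (Low y) (Low t)].
    apply; apply: card_le_trans XG _; apply: subset_card_le => t /same_mulp ut.
    exact: joined_trans (joined_sym uy) ut.
  apply: small_component => [z yz XB|v yv].
    apply: nwit; exists (@left_vertex X @` block a (inr z)), (Mid z); split.
    + by left; exists (block a (inr z)) => //; split=> //; exact: blocks_block.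
    + by exists (inr z) => //; exact: same_refl.
    + exact: joined_sym (joined_trans uy yz).
  split=> XB; apply: nwit; exists (@right_vertex X @` block b v), (right_vertex v); split;
    try exact: joined_sym (joined_trans uy yv); try by exists v => //; exact: same_refl.
  + by right; exists (block b v) => //; left; split=> //; exact: blocks_block.
  + by right; exists (block b v) => //; right; split=> //; exact: blocks_block.
- apply: regular_setU => //; first exact: small_image.
  by apply: small_image; exact: regular_setU.
Qed.

End ProductParameters.

(** * Factorisations through L and R *)

Section Factorisations.
Variable X : Type.
Hypothesis X_regular : regular X.
Implicit Types a b c : partition_monoid X.

Lemma large_fibers_card_eq (A B : set X) : [set: X] #<= A -> [set: X] #<= B -> A #= B.
Proof.
move=> /large_card_eq AX /large_card_eq BX; apply: card_eq_trans AX _.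
by rewrite card_eq_sym.
Qed.

(* In the bipartite graph behind the factorisation the left vertices are the lower
   blocks of [a], the right vertices the upper blocks of [b], and the bijection [f]
   lists its edges.  Every block [G] of [c] receives |X| of the blocks
   [H p], of size at least 2, and one of the blocks [C x], of size |X|.  One point of
   each left vertex assigned to [G] is sent into [C x], so the component of [G] is
   connected; the remaining points are matched arbitrarily. *)
Lemma factorization a b c : setL a -> setL (dualp b) ->
  [set: X] #<= dstar_set a `I_2 -> [set: X] #<= dstar_set (dualp b) [set: X] ->
  exists f g, [/\ cancel f g, cancel g f & c = mulp (mulp a (permp f)) b].
Proof.
move=> /setLP[a1 a2] /setLP[b1 b2] /card_leTP[h hinj hP] /card_leTP[h' h'inj h'P].
have {}b1 y : exists z, same b (inl z) (inr y).
  by have [z /same_dualp zy] := b1 y; exists z; exact: same_sym.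
have {}b2 y y' : same b (inr y) (inr y') -> y = y'.
  by move=> yy'; apply: b2; exact/same_dualp.
have [j jinj _] := (card_leTP _ _).1 (regular_prod X_regular).
have [j2 j2inj _] := (card_leTP _ _).1 (regular_sum X_regular).
pose x0 := regular_point X_regular.
(* [e] decodes points of [X] into vertices, so points of [X] can index the blocks of [c]. In [H p]
   the first coordinate of [p] codes a block and the second numbers |X| copies for it. *)
have [e eP] : exists e : X -> X + X, forall u, e (j2 u) = u.
  suff /choice[e eP] x : exists u, forall v, j2 v = x -> u = v by exists e => u; exact: eP.
  have [[u ux]|nx] := pselect (exists u, j2 u = x); last first.
    by exists (inl x) => v vx; case: nx; exists v.
  by exists u => v vx; apply: j2inj; rewrite ux.
pose H p := h (j p).
have HP p : [/\ blocks a (H p), upper (H p) = set0 & `I_2 #<= lower (H p)] := hP (j p).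
have Hinj : injective H by move=> p q /hinj/jinj.
pose C x : set (X + X) := @swap X @^-1` h' x.
have Cinj : injective C.
  move=> x y xy; apply: h'inj; apply/seteqP; split=> v; rewrite -(swapK v) => hv.
    by have : C x (swap v) by []; rewrite xy.
  by have : C y (swap v) by []; rewrite -xy.
have CP x : [/\ blocks b (C x), lower (C x) = set0 & [set: X] #<= upper (C x)].
  by have [/blocks_dualp] := h'P x.
(* [La] assigns the blocks of [a] to blocks of [c]: transversal ones are forced, [H p] follows its
   code, and all others go to the default block of [x0]. The first two cases cannot clash, since
   [H p] has no upper vertex. [Lb] is the mirror image. *)
have [La LaP] : exists La : set (X + X) -> set (X + X), forall B,
    [/\ forall x, blocks a B -> B (inl x) -> La B = block c (inl x),
        forall p, H p = B -> La B = block c (e p.1) & blocks c (La B)].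
  suff /choice[La LaP] B : exists G, [/\ forall x, blocks a B -> B (inl x) -> G = block c (inl x),
        forall p, H p = B -> G = block c (e p.1) & blocks c G] by exists La.
  have [[p pB]|nH] := pselect (exists p, H p = B).
    exists (block c (e p.1)); split=> [x _ Bx|q|]; last exact: blocks_block.
      by have [_ up0 _] := HP p; move: Bx; rewrite -pB -[H p _]/(upper (H p) x) up0.
    by rewrite -pB => /Hinj ->.
  have [[x [aB Bx]]|nx] := pselect (exists x, blocks a B /\ B (inl x)).
    exists (block c (inl x)); split=> [y _ By|p pB|]; last exact: blocks_block.
      by rewrite (a2 x y) //; exists B.
    by case: nH; exists p.
  exists (block c (inl x0)); split=> [y aB By|p pB|]; last exact: blocks_block.
    by case: nx; exists y.
  by case: nH; exists p.
have [Lb LbP] : exists Lb : set (X + X) -> set (X + X), forall B,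
    [/\ forall y, blocks b B -> B (inr y) -> Lb B = block c (inr y),
        forall x, C x = B -> Lb B = block c (e x) & blocks c (Lb B)].
  suff /choice[Lb LbP] B : exists G, [/\ forall y, blocks b B -> B (inr y) -> G = block c (inr y),
        forall x, C x = B -> G = block c (e x) & blocks c G] by exists Lb.
  have [[x xB]|nC] := pselect (exists x, C x = B).
    exists (block c (e x)); split=> [y _ By|y|]; last exact: blocks_block.
      by have [_ low0 _] := CP x; move: By; rewrite -xB -[C x _]/(lower (C x) y) low0.
    by rewrite -xB => /Cinj ->.
  have [[y [bB By]]|ny] := pselect (exists y, blocks b B /\ B (inr y)).
    exists (block c (inr y)); split=> [z _ Bz|p pB|]; last exact: blocks_block.
      by rewrite (b2 y z) //; exists B.
    by case: nC; exists p.
  exists (block c (inl x0)); split=> [y aB By|p pB|]; last exact: blocks_block.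
    by case: ny; exists y.
  by case: nC; exists p.
have [rep repP] : exists rep : set (X + X) -> X, forall B, blocks a B -> B (inr (rep B)).
  suff /choice[rep repP] B : exists w, blocks a B -> B (inr w) by exists rep.
  have [aB|naB] := pselect (blocks a B); last by exists x0.
  have [[x|y] ->] := blocks_inv aB; first by have [y xy] := a1 x; exists y.
  by exists y => _; exact: same_refl.
have [nrep nrepP] : exists nrep : X * X -> X, forall p,
    H p (inr (nrep p)) /\ rep (H p) <> nrep p.
  suff /choice[n nP] p : exists w, H p (inr w) /\ rep (H p) <> w by exists n.
  have [_ _ /card_I2_le[x [y [Hx Hy xy]]]] := HP p.
  have [ex|nx] := pselect (rep (H p) = x); last by exists x.
  by exists y; split=> //; rewrite ex.
have [rc rcP] : exists rc : set (X + X) -> X + X, forall G, blocks c G -> G (rc G).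
  suff /choice[rc rcP] G : exists u, blocks c G -> G u by exists rc.
  have [cG|ncG] := pselect (blocks c G); last by exists (inl x0).
  by have [u ->] := blocks_inv cG; exists u => _; exact: same_refl.
(* Each [C x] receives two disjoint copies of [X]: the [inl] copy is reserved for representatives,
   while the [inr] copy keeps the unreserved fibre large. *)
have [i iP] : exists i : X -> X + X -> X, forall x,
    injective (i x) /\ forall s, C x (inl (i x s)).
  suff /choice[i iP] x : exists i : X + X -> X, injective i /\ forall s, C x (inl (i s)) by exists i.
  have [_ _ /card_leTP[k kinj kC]] := CP x; exists (k \o j2); split=> [|s]; last exact: kC.
  exact: inj_comp.
pose xG G := j2 (rc G).
have exG G : blocks c G -> block c (e (xG G)) = G.
  by move=> cG; rewrite /xG eP -(blockE cG) //; exact: rcP.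
pose Q z := exists G s, blocks c G /\ z = i (xG G) (inl s).
(* The Boolean in the key makes [f] send exactly the representatives into the reserved set [Q]; the
   other component makes it respect the assignment to blocks of [c]. *)
pose lk w := (La (block a (inr w)), `[< rep (block a (inr w)) = w >]).
pose rk z := (Lb (block b (inl z)), `[< Q z >]).
have HE p w : H p (inr w) -> block a (inr w) = H p.
  by move=> Hw; have [aH _ _] := HP p; rewrite -(blockE aH).
have CE x z : C x (inl z) -> block b (inl z) = C x.
  by move=> Cz; have [bC _ _] := CP x; rewrite -(blockE bC).
have fib G t : lk @^-1` [set (G, t)] #= rk @^-1` [set (G, t)].
  have [cG|ncG] := pselect (blocks c G); last first.
    have -> : lk @^-1` [set (G, t)] = set0.
      by apply/seteqP; split=> // w [eG _]; apply: ncG; rewrite -eG; have [] := LaP (block a (inr w)).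
    have -> : rk @^-1` [set (G, t)] = set0.
      by apply/seteqP; split=> // w [eG _]; apply: ncG; rewrite -eG; have [] := LbP (block b (inl w)).
    exact: card_eqxx.
  apply: large_fibers_card_eq.
    have rH y : H (xG G, y) (inr (rep (H (xG G, y)))) by apply: repP; have [] := HP (xG G, y).
    have LaH y : La (H (xG G, y)) = G.
      by have [_ /(_ _ erefl) -> _] := LaP (H (xG G, y)); exact: exG.
    case: t; apply/card_leTP.
      exists (fun y => rep (H (xG G, y))) => [y y' eyy'|y] /=.
        have := HE _ _ (rH y); rewrite eyy' (HE _ _ (rH y')) => /Hinj[] //.
      by rewrite /lk (HE _ _ (rH y)) LaH; congr pair; exact/asboolP.
    exists (fun y => nrep (xG G, y)) => [y y' eyy'|y] /=.
      have := HE _ _ (nrepP (xG G, y)).1; rewrite eyy' (HE _ _ (nrepP (xG G, y')).1) => /Hinj[] //.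
    rewrite /lk (HE _ _ (nrepP _).1) LaH; congr pair; apply/asboolP; exact: (nrepP _).2.
  have LbC : Lb (C (xG G)) = G by have [_ /(_ _ erefl) -> _] := LbP (C (xG G)); exact: exG.
  have [iinj iC] := iP (xG G).
  case: t; apply/card_leTP.
    exists (fun s => i (xG G) (inl s)) => [s s' /iinj[]//|s] /=.
    by rewrite /rk (CE _ _ (iC _)) LbC; congr pair; apply/asboolP; exists G, s.
  exists (fun s => i (xG G) (inr s)) => [s s' /iinj[]//|s] /=.
  rewrite /rk (CE _ _ (iC _)) LbC; congr pair; apply/asboolP => -[G' [s' [_ es]]].
  have := CE _ _ (iC (inr s)); rewrite es (CE _ _ ((iP _).2 _)) => /Cinj exx.
  by move: es; rewrite exx => /iinj.
have [|f [g [fK gK] rf]] := @fiberwise_bijection X X _ lk rk; first by case.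
exists f, g; split=> //; set a' := mulp a (permp f).
have same_a' u v : same a' u v <-> same a (map_lower g u) (map_lower g v).
  exact: same_mulp_perm.
have lab z : Lb (block b (inl z)) = La (block a (inr (g z))).
  by have := rf (g z); rewrite gK => -[].
have LaE x B : blocks a B -> B (inl x) -> La B = block c (inl x) by move=> *; have [] := LaP B; auto.
have LbE y B : blocks b B -> B (inr y) -> Lb B = block c (inr y) by move=> *; have [] := LbP B; auto.
apply: same_ext => u v; rewrite same_mulp; split=> uv; last first.
  (* The assignment is constant along edges, so joined outer vertices lie in one block of [c]. *)
  pose phi p := match p with
    | Up x => block c (inl x) | Mid z => Lb (block b (inl z)) | Low y => block c (inr y) end.
  have outE w : phi (outer_vertex w) = block c w by case: w.
  apply/eq_blockP; rewrite -!outE; apply: (joined_label (f := phi)) uv => s t.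
    have leftE w : phi (left_vertex w) = La (block a (map_lower g w)).
      case: w => [x|z] /=; last exact: lab.
      by rewrite (LaE x) //; [exact: blocks_block|exact: same_refl].
    by rewrite !leftE => /same_a'/eq_block ->.
  have rightE w : phi (right_vertex w) = Lb (block b w).
    by case: w => [z|y] //=; rewrite (LbE y) //; [exact: blocks_block|exact: same_refl].
  by rewrite !rightE => /eq_block ->.
pose center G := Mid (i (xG G) (inl x0)).
(* Conversely, go from [z] to the image of the representative of its [a]-block. That image lies in
   the large block [C (xG G)], which also contains the centre. *)
have mid z : joined a' b (Mid z) (center (Lb (block b (inl z)))).
  set G := Lb _; set r := rep (block a (inr (g z))).
  have zr : same a (inr (g z)) (inr r) by apply: repP; exact: blocks_block.
  apply: (@joined_trans _ _ _ _ (Mid (f r))).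
    by apply: (@joined_left _ _ _ (inr z) (inr (f r))); apply/same_a'; rewrite /= fK.
  have [La_r /asboolP Qr] : Lb (block b (inl (f r))) = G /\ `[< Q (f r) >].
    have [-> ->] : rk (f r) = lk r := rf r.
    rewrite -(eq_block zr) /G lab; split=> //; exact/asboolP.
  have [G' [s [cG' fr]]] := Qr.
  have frC : C (xG G') (inl (f r)) by rewrite fr; exact: (iP _).2.
  have eG : G' = G.
    by rewrite -La_r (CE _ _ frC); have [_ /(_ _ erefl) -> _] := LbP (C (xG G')); rewrite exG.
  rewrite -eG; apply: (@joined_right _ _ _ (inl (f r)) (inl _)).
  by exists (C (xG G')); [have [] := CP (xG G') | split=> //; exact: (iP _).2].
have out w : joined a' b (outer_vertex w) (center (block c w)).
  case: w => [x|y].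
    have [y xy] := a1 x; have xfy : same a' (inl x) (inr (f y)) by apply/same_a'; rewrite /= fK.
    have -> : block c (inl x) = Lb (block b (inl (f y))).
      by rewrite lab fK (LaE x) //; [exact: blocks_block|exact: same_sym].
    exact: joined_trans (joined_left b xfy) (mid _).
  have [z zy] := b1 y.
  have -> : block c (inr y) = Lb (block b (inl z)) by rewrite (LbE y) //; exact: blocks_block.
  exact: joined_trans (joined_right a' (same_sym zy)) (mid _).
by apply: joined_trans (out u) _; rewrite (eq_block uv); exact: joined_sym.
Qed.

(** The permutation attaches |X| lower nontransversal blocks of the first [a] to upper vertices of
    transversal blocks of the second [a] with lower part at least |M|. This cuts those blocks off
    from the upper row and keeps their lower parts. *)
Lemma dstar_amplification a U (M : set U) : setL a ->
  [set: X] #<= dstar_set a `I_1 -> [set: X] #<= kstar_set a M ->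
  exists f g, [/\ cancel f g, cancel g f &
    [set: X] #<= dstar_set (mulp (mulp a (permp f)) a) M].
Proof.
move=> /setLP[a1 a2] /card_leTP[h hinj hP] /card_leTP[k kinj kP].
have [j jinj _] := (card_leTP _ _).1 (regular_sum X_regular).
have [p pP] : exists p : X -> X, forall x, h x (inr (p x)).
  suff /choice[p pP] x : exists w, h x (inr w) by exists p.
  by have [_ _ /card_I1_le[w]] := hP x; exists w.
have pE x : block a (inr (p x)) = h x by have [ah _ _] := hP x; rewrite -(blockE ah).
have pinj : injective p by move=> x y exy; apply: hinj; rewrite -!pE exy.
have [r rP] : exists r : X -> X, forall x, k x (inl (r x)).
  suff /choice[r rP] x : exists w, k x (inl w) by exists r.
  by have [_ [[w]]] := kP x; exists w.
have rE x : block a (inl (r x)) = k x by have [ak _ _] := kP x; rewrite -(blockE ak).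
have rinj : injective r by move=> x y exy; apply: kinj; rewrite -!rE exy.
(* Only the [inl] half of the indices is matched; the [inr] half keeps the complement large, so that
   the matching extends to a permutation. *)
have large q t : injective q -> [set: X] #<=
    (fun w => `[< exists s, w = q (j (inl s)) >]) @^-1` [set t].
  move=> qinj; apply/card_leTP; case: t.
    by exists (fun s => q (j (inl s))) => [s s' /qinj/jinj[]|s] //=; apply/asboolP; exists s.
  exists (fun s => q (j (inr s))) => [s s' /qinj/jinj[]|s] //=; apply/asboolP => -[s'].
  by move/qinj/jinj.
have [t|f [g [fK gK] rf]] := @fiberwise_bijection X X _
    (fun w => `[< exists s, w = p (j (inl s)) >]) (fun w => `[< exists s, w = r (j (inl s)) >]).
  by apply: large_fibers_card_eq; exact: large.
exists f, g; split=> //; set a' := mulp a (permp f).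
have same_a' u v : same a' u v <-> same a (map_lower g u) (map_lower g v).
  exact: same_mulp_perm.
pose w s := p (j (inl s)).
have kf s : exists x, block a (inl (f (w s))) = k x.
  have : `[< exists s', f (w s) = r (j (inl s')) >] by rewrite rf; apply/asboolP; exists s.
  by move/asboolP => [s' ->]; exists (j (inl s')).
have [y yP] : exists y : X -> X, forall s, same a (inl (f (w s))) (inr (y s)).
  by have [y yP] := choice (fun s => a1 (f (w s))); exists y.
(* Going up from [Low (y s)] ends in the nontransversal block of [w s], so no upper vertex is
   reached. The block also determines [s]. *)
pose E s := [set q | match q with
  | Up x => False
  | Mid z => same a (inr (w s)) (inr (g z))
  | Low t => exists2 z, same a (inr (w s)) (inr (g z)) & same a (inl z) (inr t) end].
have EP s q : joined a' a (Low (y s)) q -> E s q.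
  move=> yq; apply: (joined_ind (E := E s) _ _ yq) => [u v /same_a' | u v |].
  - case: u v => [u|u] [v|v] uv //=; last by move/same_trans; exact.
    move=> wu; have /= wv := same_trans wu uv.
    have [ah up0 _] := hP (j (inl s)).
    have : upper (h (j (inl s))) v by rewrite -pE.
    by rewrite up0.
  - case: u v => [u|u] [v|v] uv //=.
    + by rewrite (a2 _ _ uv).
    + by move=> wu; exists u.
    + by case=> z wz zu; rewrite -(a2 z v) //; exact: same_trans uv.
    + by case=> z wz zu; exists z => //; exact: same_trans uv.
  - by exists (f (w s)); [rewrite fK; exact: same_refl|exact: yP].
apply/card_leTP; exists (fun s => block (mulp a' a) (inr (y s))) => [s s'|s].
  move=> /eq_blockP/same_mulp/EP[z wz zy]; have zE : z = f (w s').
    by apply: a2; apply: same_trans zy (same_sym (yP s')).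
  move: wz; rewrite zE fK => /eq_block; rewrite !pE => /hinj/jinj[] //.
split; first exact: blocks_block.
  by apply/seteqP; split=> // x /same_mulp/EP.
have [x kx] := kf s; have [_ _ Mk] := kP x; apply: card_le_trans Mk _.
rewrite -kx; apply: subset_card_le => t wt; apply/same_mulp.
exact: (@joined_right _ a' a (inr (y s)) (inr t)) (same_trans (same_sym (yP s)) wt).
Qed.

End Factorisations.

(** * The cardinal conditions in terms of lower parts *)

Lemma disjoint_sum_setU T (A B : set T) : A `&` B = set0 -> disjoint_sum A B #= A `|` B.
Proof.
move=> AB; pose f (u : T + T) := match u with inl x => x | inr x => x end.
have fAB : f @` disjoint_sum A B = A `|` B.
  apply/seteqP; split=> [_ [_ [[x Ax <-]|[x Bx <-]] <-]|x [Ax|Bx]]; [by left|by right| |].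
    by exists (inl x) => //; left; exists x.
  by exists (inr x) => //; right; exists x.
rewrite -fAB card_eq_sym; apply: inj_card_eq => u v /set_mem + /set_mem.
have nAB x : A x -> B x -> False by move=> Ax Bx; have : (A `&` B) x by []; rewrite AB.
move=> [[x Ax <-]|[x Bx <-]] [[y Ay <-]|[y By <-]] /= exy; rewrite ?exy //.
  by case: (nAB x) => //; rewrite exy.
by case: (nAB x) => //; rewrite exy.
Qed.

Section Conditions.
Variable X : Type.
Hypothesis X_regular : regular X.
Implicit Types a b c : partition_monoid X.

Lemma low_setE U a (M : set U) : M !=set0 ->
  low_set a M = kstar_set a M `|` dstar_set a M.
Proof.
move=> M0; apply/seteqP; split=> [B [aB MB]|B [[]|[]]] //.
have [B0|/set0P upB] := eqVneq (upper B) set0; [by right|left; split=> //; split=> //].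
by apply/set0P; apply: contraTneq MB => ->; rewrite card_le0; exact/set0P.
Qed.

Lemma disjoint_sum_low U a (M : set U) : M !=set0 ->
  disjoint_sum (kstar_set a M) (dstar_set a M) #= low_set a M.
Proof.
move=> M0; rewrite low_setE //; apply: disjoint_sum_setU.
apply/seteqP; split=> // B [[_ [[x Bx] _] _] [_ up0 _]].
by have : upper B x := Bx; rewrite up0.
Qed.

Lemma swap_preimageK (B : set (X + X)) : @swap X @^-1` (@swap X @^-1` B) = B.
Proof. by apply/seteqP; split=> v /=; rewrite swapK. Qed.

Lemma swap_image_card (S : set (set (X + X))) : preimage (@swap X) @` S #= S.
Proof.
by apply: inj_card_eq => A B _ _ e; rewrite -(swap_preimageK A) e swap_preimageK.
Qed.

Lemma d_set_dualp U b (M : set U) : d_set b M = preimage (@swap X) @` dstar_set (dualp b) M.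
Proof.
apply/seteqP; split=> [B [bB B0 MB]|_ [B [/blocks_dualp bB B0 MB] <-]] //.
exists (@swap X @^-1` B); last exact: swap_preimageK.
by split=> //; apply/blocks_dualp; rewrite swap_preimageK.
Qed.

Lemma k_set_dualp U b (M : set U) : k_set b M = preimage (@swap X) @` kstar_set (dualp b) M.
Proof.
apply/seteqP; split=> [B [bB [upB lowB] MB]|_ [B [/blocks_dualp bB [upB lowB] MB] <-]] //.
exists (@swap X @^-1` B); last exact: swap_preimageK.
by split=> //; apply/blocks_dualp; rewrite swap_preimageK.
Qed.

Lemma disjoint_sum_up U b (M : set U) : M !=set0 ->
  disjoint_sum (k_set b M) (d_set b M) #= low_set (dualp b) M.
Proof.
move=> M0; apply: card_eq_trans (disjoint_sum_setU _) _.
  apply/seteqP; split=> // B [[_ [_ [x Bx]] _] [_ low0 _]].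
  by have : lower B x := Bx; rewrite low0.
by rewrite k_set_dualp d_set_dualp -image_setU -low_setE //; exact: swap_image_card.
Qed.

Lemma card_blocks a : blocks a #<= [set: X].
Proof.
apply: card_le_trans (regular_sum X_regular).
have -> : blocks a = range (block a).
  apply/seteqP; split=> [B /blocks_inv[u ->]|_ [u _ <-]]; first by exists u.
  exact: blocks_block.
exact: card_image_le.
Qed.

(** There are at most |X + X| = |X| blocks, so only the lower bound carries information. *)
Lemma blocks_card_eq a (S : set (set (X + X))) : S `<=` blocks a ->
  (S #= [set: X]) = ([set: X] #<= S).
Proof.
move=> Sa; rewrite card_eq_le (card_le_trans (subset_card_le Sa) (card_blocks a)) //.
Qed.

(** The conditions of the theorem, with [b] seen through its dual and each equality of cardinals
    reduced to an inequality. *)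
Definition balanced (a b : partition_monoid X) : Prop :=
  [/\ setL a, setL (dualp b),
      [set: X] #<= dstar_set a `I_1,
      [set: X] #<= dstar_set (dualp b) `I_1 &
      ([set: X] #<= low_set a `I_2 /\ [set: X] #<= low_set (dualp b) [set: X]) \/
      ([set: X] #<= low_set a [set: X] /\ [set: X] #<= low_set (dualp b) `I_2)].

Lemma conditionsE a b :
  [/\ setL a, setR b,
      dstar_set a `I_1 #= [set: X],
      d_set b `I_1 #= [set: X] &
      (disjoint_sum (kstar_set a `I_2) (dstar_set a `I_2) #= [set: X] /\
       disjoint_sum (k_set b [set: X]) (d_set b [set: X]) #= [set: X])
      \/
      (disjoint_sum (kstar_set a [set: X]) (dstar_set a [set: X]) #= [set: X] /\
       disjoint_sum (k_set b `I_2) (d_set b `I_2) #= [set: X])] <-> balanced a b.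
Proof.
have X0 : [set: X] !=set0 by exists (regular_point X_regular).
have I0 : `I_2 !=set0 by exists 0.
have lowE c U (M : set U) : (low_set c M #= [set: X]) = ([set: X] #<= low_set c M).
  by apply: (@blocks_card_eq c) => B [].
rewrite (@blocks_card_eq a _) => [|B []//].
rewrite d_set_dualp (card_eql (swap_image_card _)) (@blocks_card_eq (dualp b) _) => [|B []//].
rewrite !(card_eql (disjoint_sum_low _ _)) // !(card_eql (disjoint_sum_up _ _)) // !lowE.
by rewrite /balanced (propext (setR_dualp b)).
Qed.

End Conditions.

(** * Generation and its invariance under duality *)

Definition generating X (a b : partition_monoid X) : Prop :=
  forall T : set (partition_monoid X), subsemigroup T -> @units X `<=` T -> T a -> T b ->
  forall c, T c.

(** The quantified form suits both directions: sufficiency builds [c] inside an arbitrary [T],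
    necessity chooses a proper [T]. *)
Lemma generatingE X (a b : partition_monoid X) :
  generated (@units X `|` [set a; b]) = [set: partition_monoid X] <-> generating a b.
Proof.
split=> [gen T sT uT Ta Tb c|gen].
  have : generated (@units X `|` [set a; b]) c by rewrite gen.
  by apply; split=> // d [/uT//|[->|->]].
by rewrite -subTset => c _ T [/= sT uT]; apply: gen => //; [move=> d ud|..]; apply: uT;
  [left|right; left|right; right].
Qed.

Lemma subsemigroup_dualp X (T : set (partition_monoid X)) :
  subsemigroup T -> subsemigroup [set c | T (dualp c)].
Proof. by move=> sT a b Ta Tb; rewrite /= dualp_mulp; exact: sT. Qed.

Lemma generating_dualp X (a b : partition_monoid X) :
  generating a b -> generating (dualp a) (dualp b).
Proof.
move=> gen T sT uT Ta Tb c; rewrite -(dualpK c).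
by apply: (gen _ (subsemigroup_dualp sT)) => // d /dualp_units/uT.
Qed.

Lemma generating_sym X (a b : partition_monoid X) : generating a b -> generating b a.
Proof. by move=> gen T sT uT Ta Tb; exact: gen. Qed.

(** * Generating pairs *)

Section Characterization.
Variable X : Type.
Hypothesis X_uncountable : ~ countable [set: X].
Hypothesis X_regular : regular X.
Implicit Types a b c : partition_monoid X.

(** By regularity the transversal or the nontransversal lower parts of size at least |M| already
    number |X|; in the former case amplification applies. *)
Lemma exists_large_dstar_setL (T : set (partition_monoid X)) a U (M : set U) : M !=set0 ->
  subsemigroup T -> @units X `<=` T -> T a -> setL a ->
  [set: X] #<= dstar_set a `I_1 -> [set: X] #<= low_set a M ->
  exists a', [/\ T a', setL a' & [set: X] #<= dstar_set a' M].
Proof.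
move=> M0 sT uT Ta La da la.
have [dM|nd] := pselect ([set: X] #<= dstar_set a M); first by exists a.
have [kM|nk] := pselect ([set: X] #<= kstar_set a M); last first.
  by case: (regular_setU X_regular nk nd); rewrite -low_setE.
have [f [g [fK gK dM]]] := dstar_amplification X_regular La da kM.
have Uf := permp_unit fK gK.
exists (mulp (mulp a (permp f)) a); split=> //; first exact: (sT _ _ (sT _ _ Ta (uT _ Uf)) Ta).
exact: (setL_mulp (setL_mulp La (setL_units Uf)) La).
Qed.

Lemma sufficiency a b : balanced a b -> generating a b.
Proof.
have first_case a' b' : setL a' -> setL (dualp b') ->
    [set: X] #<= dstar_set a' `I_1 -> [set: X] #<= dstar_set (dualp b') `I_1 ->
    [set: X] #<= low_set a' `I_2 -> [set: X] #<= low_set (dualp b') [set: X] ->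
    generating a' b'.
  move=> La Rb da db la lb T sT uT Ta Tb c.
  have I0 : `I_2 !=set0 by exists 0.
  have X0 : [set: X] !=set0 by exists (regular_point X_regular).
  have [a2 [Ta2 La2 da2]] := exists_large_dstar_setL I0 sT uT Ta La da la.
  (* The same replacement is made for the dual of [b] inside the dual subsemigroup. *)
  have [|||b2 [Tb2 Lb2 db2]] := exists_large_dstar_setL (T := [set c | T (dualp c)]) X0 _ _ _ Rb db lb.
  - exact: subsemigroup_dualp.
  - by move=> d /dualp_units/uT.
  - by rewrite /= dualpK.
  have [f [g [fK gK ->]]] : exists f g, [/\ cancel f g, cancel g f &
      c = mulp (mulp a2 (permp f)) (dualp b2)].
    by apply: factorization; rewrite ?dualpK.
  exact: (sT _ _ (sT _ _ Ta2 (uT _ (permp_unit fK gK))) Tb2).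
case=> La Rb da db [[la lb]|[la lb]]; first exact: first_case.
(* Alternative (ii) for a pair is alternative (i) for the duals in exchanged order. *)
have h : generating (dualp b) (dualp a) by apply: first_case; rewrite ?dualpK.
by have := generating_sym (generating_dualp h); rewrite !dualpK.
Qed.

(** The rows of [X * X], embedded in the lower vertices, give |X| lower blocks of size |X|. This one
    partition lies outside each of the subsemigroups defined by counting. *)
Lemma exists_large_dstar : exists c, [set: X] #<= dstar_set c [set: X].
Proof.
have [j jinj _] := (card_leTP _ _).1 (regular_prod X_regular).
have [q qP] : exists q : X -> X, forall p, q (j p) = p.1.
  suff /choice[q qP] y : exists x, forall p, j p = y -> x = p.1 by exists q => p; exact: qP.
  have [[p py]|np] := pselect (exists p, j p = y); last by exists y => p py; case: np; exists p.
  by exists p.1 => p' p'y; congr fst; apply: jinj; rewrite py.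
pose c : partition_monoid X :=
  kerp (fun u => match u with inl _ => None | inr y => Some (q y) end).
exists c; apply/card_leTP; exists (fun x => block c (inr (j (x, x)))) => [x y|x].
  by move/eq_blockP/same_kerp; rewrite !qP => -[].
split; first exact: blocks_block.
  by apply/seteqP; split=> // y /same_kerp.
apply/card_leTP; exists (fun y => j (x, y)) => [y y' /jinj[]|y] //.
by apply/same_kerp; rewrite !qP.
Qed.

(** A non-surjective injection of [X] into itself serves as key; the lower vertex [j (inr x0)] is
    missed. *)
Lemma exists_proper_setL : exists2 c : partition_monoid X, setL c & ~ setL (dualp c).
Proof.
have [j jinj _] := (card_leTP _ _).1 (regular_sum X_regular).
pose x0 := regular_point X_regular.
exists (kerp (fun u => match u with inl x => j (inl x) | inr y => y end)).
  apply/setLP; split=> [x|x y /same_kerp/jinj[]//].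
  by exists (j (inl x)); apply/same_kerp.
move=> /setLP[/(_ (j (inr x0)))[y /same_dualp/same_kerp /= /jinj]] //.
Qed.

Lemma dstar_sub_low U V c (M : set U) (N : set V) : N #<= M ->
  (dstar_set c M `<=` dstar_set c N) /\ (dstar_set c M `<=` low_set c N).
Proof.
by move=> NM; split=> B [cB B0 MB]; split=> //; exact: card_le_trans NM MB.
Qed.

Lemma setL_dualp_lower c U (M : set U) : setL (dualp c) -> `I_2 #<= M -> low_set c M = set0.
Proof.
move=> /setLP[_ d2] IM; apply/seteqP; split=> // B [cB MB].
have [x [y [Bx By]]] := (card_I2_le _).1 (card_le_trans IM MB).
by apply; apply: d2; apply/same_dualp; exists B.
Qed.

Lemma setL_dualp_dstar c U (M : set U) : setL (dualp c) -> `I_1 #<= M -> dstar_set c M = set0.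
Proof.
move=> /setLP[d1 _] IM; apply/seteqP; split=> // B [cB B0 MB].
have [x Bx] := (card_I1_le _).1 (card_le_trans IM MB).
have [y /same_dualp xy] := d1 x; have : upper B y by rewrite (blockE cB Bx).
by rewrite B0.
Qed.

Lemma small0 T : small X (@set0 T).
Proof. exact/(regular_not_finite X_regular)/finite_set0. Qed.

(** The complement of L minus R is closed under products: if [mulp d e] is in L then so is [d],
    which is therefore a permutation, and cancelling it puts [e] in L as well. *)
Lemma generating_proper_setL a b : generating a b ->
  (setL a /\ ~ setL (dualp a)) \/ (setL b /\ ~ setL (dualp b)).
Proof.
move=> gen; apply: contrapT => /not_orP[na nb].
have [c Lc] := exists_proper_setL; apply.
apply: (gen [set d | setL d -> setL (dualp d)]) Lc => [d e Pd Pe Lde|d /dualp_units/setL_units dL _ //||].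
- have Ld := setL_mulpl Lde; have [f [g [fK gK dE]]] := setL_dualp_perm Ld (Pd Ld).
  have Le : setL e by apply: (setL_mul_perm fK gK); rewrite -dE.
  by rewrite dualp_mulp; exact: setL_mulp (Pe Le) (Pd Ld).
- by move=> La; apply: contrapT => nLa; exact: na (conj La nLa).
- by move=> Lb; apply: contrapT => nLb; exact: nb (conj Lb nLb).
Qed.

Lemma I1_le_I2 : `I_1 #<= `I_2. Proof. by rewrite card_le_II. Qed.
Lemma I2_le_X : `I_2 #<= [set: X].
Proof. by apply: countable_le_regular => //; exact: countableP. Qed.

Lemma generating_dstar a b : generating a b -> setL (dualp b) ->
  [set: X] #<= dstar_set a `I_1.
Proof.
move=> gen Rb; apply: contrapT => sa; have [c cX] := exists_large_dstar.
have : small X (dstar_set c `I_1).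
  apply: (gen [set d | small X (dstar_set d `I_1)]) => // [d e sd se|d ud|].
  - exact: small_dstar_mulp.
  - by rewrite /= setL_dualp_dstar //; [exact: small0|exact/setL_units/dualp_units].
  - by rewrite /= setL_dualp_dstar //; exact: small0.
apply; apply: card_le_trans cX (subset_card_le _).
exact: (dstar_sub_low _ (card_le_trans I1_le_I2 I2_le_X)).1.
Qed.

Lemma generating_low2 a b : generating a b -> setL (dualp b) ->
  [set: X] #<= low_set a `I_2.
Proof.
move=> gen Rb; apply: contrapT => sa; have [c cX] := exists_large_dstar.
have : small X (low_set c `I_2).
  apply: (gen [set d | small X (low_set d `I_2)]) => // [d e sd se|d ud|].
  - exact: small_low2_mulp.
  - by rewrite /= setL_dualp_lower //; [exact: small0|exact/setL_units/dualp_units].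
  - by rewrite /= setL_dualp_lower //; exact: small0.
apply; apply: card_le_trans cX (subset_card_le _).
exact: (dstar_sub_low _ I2_le_X).2.
Qed.

(** The invariant bounds lower and upper parts together, so it is self-dual and its closure under
    products follows from [small_low_mulp] used on both sides. *)
Lemma generating_low_full a b : generating a b -> setL a -> setL (dualp b) ->
  [set: X] #<= low_set a [set: X] \/ [set: X] #<= low_set (dualp b) [set: X].
Proof.
move=> gen La Rb; apply: contrapT => /not_orP[sa sb]; have [c cX] := exists_large_dstar.
have low0 (d : partition_monoid X) : setL d -> small X (low_set (dualp d) [set: X]).
  by move=> Ld; rewrite setL_dualp_lower ?dualpK //; [exact: small0|exact: I2_le_X].
have [+ _] : small X (low_set c [set: X]) /\ small X (low_set (dualp c) [set: X]).
  apply: (gen [set d | small X (low_set d [set: X]) /\ small X (low_set (dualp d) [set: X])])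
    => // [d e [sd sd'] [se se']|d ud||].
  - split=> /=; first exact: small_low_mulp.
    by rewrite dualp_mulp; apply: small_low_mulp; rewrite ?dualpK.
  - split; last exact/low0/setL_units.
    by rewrite -(dualpK d); exact/low0/setL_units/dualp_units.
  - by split=> //; exact: low0.
  - by split=> //; rewrite -(dualpK b); exact: low0.
apply; apply: card_le_trans cX (subset_card_le _).
exact: (dstar_sub_low _ (card_lexx _)).2.
Qed.

Lemma necessity a b : generating a b -> balanced a b \/ balanced b a.
Proof.
have conclude a' b' : generating a' b' -> setL a' -> setL (dualp b') -> balanced a' b'.
  move=> gen La Rb; have gen' := generating_sym (generating_dualp gen).
  have La' : setL (dualp (dualp a')) by rewrite dualpK.
  split=> //; [exact: generating_dstar gen Rb|exact: generating_dstar gen' La'|].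
  have la2 := generating_low2 gen Rb; have lb2 := generating_low2 gen' La'.
  by case: (generating_low_full gen La Rb) => h; [right|left].
(* One generator lies in L but not R and, by duality, one lies in R but not L. They cannot coincide,
   which leaves the two namings. *)
move=> gen; have := generating_proper_setL (generating_dualp gen); rewrite !dualpK.
case: (generating_proper_setL gen) => -[L nR] [[R nL]|[R nL]] //.
  by left; exact: conclude.
by right; apply: conclude => //; exact: generating_sym.
Qed.

End Characterization.

Theorem theorem19 (X : Type) (X_uncountable : ~ countable [set: X])
    (X_regular : regular X) (alpha beta : partition_monoid X) :
  let conditions (a b : partition_monoid X) : Prop :=
    [/\ setL a, setR b,
        dstar_set a `I_1 #= [set: X],
        d_set b `I_1 #= [set: X] &
        (disjoint_sum (kstar_set a `I_2) (dstar_set a `I_2) #= [set: X] /\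
         disjoint_sum (k_set b [set: X]) (d_set b [set: X]) #= [set: X])
        \/
        (disjoint_sum (kstar_set a [set: X]) (dstar_set a [set: X]) #= [set: X] /\
         disjoint_sum (k_set b `I_2) (d_set b `I_2) #= [set: X])] in
  generated (@units X `|` [set alpha; beta]) = [set: partition_monoid X] <->
  conditions alpha beta \/ conditions beta alpha.
Proof.
move=> conditions; rewrite generatingE /conditions !(propext (conditionsE X_regular _ _)).
split=> [gen|[h|h]].
- exact: necessity.
- exact: sufficiency.
- by apply: generating_sym; exact: sufficiency.
Qed.
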